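(* Let $\mathcal{S} = (X, \{R_i\}_{i=0}^d)$ be a commutative symmetric association scheme with $d \geq 1$ classes and intersection numbers $p_{ij}^k$, and let $$\mathcal{I} = \Big\langle\, x_0 - 1,\ \ x_i x_j - p_{ij}^0 - \sum_{k=1}^{d} p_{ij}^k x_k \ \ (1 \leq i \leq j \leq d) \Big\rangle \subset \mathbb{C}[x_0, x_1, \ldots, x_d]$$ be its associated ideal. Then $\mathcal{S}$ is P-polynomial if and only if there exist an ordering $x_{i_0}, x_{i_1}, \ldots, x_{i_d}$ of the variables with $i_0 = 0$ and $\{i_1, \ldots, i_d\} = \{1, \ldots, d\}$, a pure lexicographical monomial ordering with $x_{i_1} < x_{i_j}$ for all $j = 2, \ldots, d$, and univariate polynomials $p, p_2, \ldots, p_d$ with complex coefficients, such that $$\{\, x_0 - 1,\ p(x_{i_1}),\ x_{i_2} - p_2(x_{i_1}),\ \ldots,\ x_{i_d} - p_d(x_{i_1}) \,\}$$ is a Gröbner basis of $\mathcal{I}$ for that monomial ordering, and $$\deg(p_j) = j \quad \text{for all } j = 2, \ldots, d, \qquad \deg(p) = d+1.$$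
   Context: An association scheme with $d$ classes is a pair $\mathcal{S} = (X, \{R_i\}_{i=0}^d)$ consisting of a finite set $X$ and relations $R_i \subseteq X \times X$ such that: (1) $R_0 = \{(x,x) \mid x \in X\}$; (2) $\{R_i\}_{i=0}^d$ is a partition of $X \times X$ (into nonempty classes); (3) for every $i$ there is $j$ with $R_i^t = R_j$, where $R_i^t = \{(y,x) \mid (x,y) \in R_i\}$; (4) for all $i,j,k \in \{0,\ldots,d\}$ the number $p_{ij}^k = |\{z \in X \mid (x,z) \in R_i,\ (z,y) \in R_j\}|$ is the same for all $(x,y) \in R_k$. The numbers $p_{ij}^k$ are the intersection numbers. The scheme is commutative if $p_{ij}^k = p_{ji}^k$ for all $i,j,k$, and symmetric if $R_i^t = R_i$ for all $i$. The adjacency matrix $D_i$ of $R_i$ is the $|X| \times |X|$ matrix with $D_i(x,y) = 1$ if $(x,y) \in R_i$ and $0$ otherwise; thus $D_0$ is the identity and $D_i D_j = \sum_{k=0}^d p_{ij}^k D_k$. The scheme is called P-polynomial if the relations $R_1, \ldots, R_d$ can be reordered (keeping $R_0$ the diagonal relation) so that, after reordering, each $D_i$ is a polynomial $p_i$ of degree $i$ in $D_1$, and $p(x_1)$ is a polynomial in $x_1$ whose roots are the eigenvalues of $D_1$. *)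

(* Defs.v *)
From HB Require Import structures.
From mathcomp Require Import all_boot all_order all_fingroup all_algebra.
From mathcomp Require Import reals complex mpoly.

Set Implicit Arguments.
Unset Strict Implicit.
Unset Printing Implicit Defensive.

Import GRing.Theory.
Local Open Scope ring_scope.

Section Scheme.
Variable X : finType.

Definition transpose_rel (A : {set X * X}) : {set X * X} :=
  [set (xy.2, xy.1) | xy in A].

(* [partition] includes nonemptiness of the classes; [srel_inj] says that
   distinct indices give distinct classes.  The intersection numbers are
   carried as data: they are determined by [inumP] since no class is empty. *)
Record assoc_scheme (d : nat) := AssocScheme {
  srel : 'I_d.+1 -> {set X * X};
  inum : 'I_d.+1 -> 'I_d.+1 -> 'I_d.+1 -> nat;
  srel0 : srel ord0 = [set (x, x) | x : X];
  srel_inj : injective srel;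
  srel_partition : partition [set srel i | i : 'I_d.+1] [set: X * X];
  srel_transpose : forall i, exists j, transpose_rel (srel i) = srel j;
  inumP : forall i j k x y, (x, y) \in srel k ->
    #|[set z | ((x, z) \in srel i) && ((z, y) \in srel j)]| = inum i j k
}.

Variables (d : nat) (S : assoc_scheme d).

Definition commutative_scheme : Prop :=
  forall i j k, inum S i j k = inum S j i k.

Definition symmetric_scheme : Prop :=
  forall i, transpose_rel (srel S i) = srel S i.

Definition adjacency_mx (F : fieldType) (i : 'I_d.+1) : 'M[F]_#|X| :=
  \matrix_(a, b) ((enum_val a, enum_val b) \in srel S i)%:R.

End Scheme.

(* [horner_mx] needs a dimension that is syntactically a successor. *)
Definition mx_eval (F : fieldType) (n : nat) (p : {poly F}) (A : 'M[F]_n)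
    : 'M[F]_n :=
  \sum_(k < size p) p`_k *: A ^+ k.

(* [s] is the reordering of the relations, with [s i] the old index of the
   i-th relation.  For 0 < d, [inord 1 : 'I_d.+1] is the index 1. *)
Definition P_polynomial (F : fieldType) (X : finType) (d : nat)
    (S : assoc_scheme X d) : Prop :=
  exists (s : 'S_d.+1) (q : 'I_d.+1 -> {poly F}) (p : {poly F}),
    let D i := adjacency_mx S F (s i) in
    [/\ s ord0 = ord0,
        forall i, size (q i) = i.+1 /\ D i = mx_eval (q i) (D (inord 1))
      & forall a, root p a <-> eigenvalue (D (inord 1)) a].

Section Groebner.
Variables (F : fieldType) (n : nat).
Local Notation P := {mpoly F[n]}.

Definition ideal_gen (A : P -> Prop) (f : P) : Prop :=
  exists s : seq (P * P),
    (forall cg, cg \in s -> A cg.2) /\ f = \sum_(cg <- s) cg.1 * cg.2.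

(* Pure lexicographic order in which the variables are, from the largest to
   the smallest, 'X_(t 0), 'X_(t 1), ... *)
Definition lex_lt (t : 'S_n) (m m' : 'X_{1..n}) : bool :=
  [exists k : 'I_n, (m (t k) < m' (t k))%N
    && [forall j : 'I_n, (j < k)%N ==> (m (t j) == m' (t j))]].

Definition lex_le (t : 'S_n) (m m' : 'X_{1..n}) : bool :=
  (m == m') || lex_lt t m m'.

(* No monomial is leading in the zero polynomial, whose support is empty. *)
Definition leading_monomial (le : rel 'X_{1..n}) (f : P) (m : 'X_{1..n})
    : Prop :=
  m \in msupp f /\ forall m', m' \in msupp f -> le m' m.

Definition leading_terms (le : rel 'X_{1..n}) (A : P -> Prop) (h : P) : Prop :=
  exists f m, [/\ A f, leading_monomial le f m & h = f@_m *: 'X_[m]].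

Definition groebner_basis (le : rel 'X_{1..n}) (I : P -> Prop) (G : seq P)
    : Prop :=
  (forall g, g \in G -> I g) /\
  (forall f, ideal_gen (leading_terms le (fun g => g \in G)) f <->
             ideal_gen (leading_terms le I) f).

End Groebner.

Definition scheme_ideal_generator (F : fieldType) (X : finType) (d : nat)
    (S : assoc_scheme X d) (f : {mpoly F[d.+1]}) : Prop :=
  f = 'X_ord0 - 1 \/
  exists i j : 'I_d.+1, (1 <= i <= j)%N /\
    f = 'X_i * 'X_j - (inum S i j ord0)%:R
        - \sum_(k < d.+1 | (1 <= k)%N) (inum S i j k)%:R *: 'X_k.

Definition scheme_ideal (F : fieldType) (X : finType) (d : nat)
    (S : assoc_scheme X d) : {mpoly F[d.+1]} -> Prop :=
  ideal_gen (@scheme_ideal_generator F X d S).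

Arguments scheme_ideal F {X d} S f.

(* x_0 - 1, p(x_(s 1)), and x_(s j) - q_j(x_(s 1)) for 2 <= j <= d. *)
Definition triangular_system (F : fieldType) (d : nat) (s : 'S_d.+1)
    (p : {poly F}) (q : 'I_d.+1 -> {poly F}) : seq {mpoly F[d.+1]} :=
  let x1 : {mpoly F[d.+1]} := 'X_(s (inord 1)) in
  [:: 'X_ord0 - 1, horner_alg x1 p
    & [seq 'X_(s j) - horner_alg x1 (q j)
        | j : 'I_d.+1 <- enum 'I_d.+1 & (2 <= j)%N]].

(* Main.v *)
(* Evaluation at the adjacency matrices, x_i |-> D_i, has kernel exactly the
   scheme ideal: modulo the ideal every polynomial reduces to a linear form in
   the x_i, and the D_i are linearly independent.  Hence x_j - p_j(x_1) lies in
   the ideal iff D_j = p_j(D_1), which gives the converse direction without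
   using the leading-term condition.  For the direct one, no nonzero
   polynomial of degree at most d kills D_1, while a polynomial p of degree
   d + 1 does.  If x_1 is the smallest variable, a leading monomial of an
   element of the ideal that no other leading monomial of the system divides
   is a power of x_1; the element is then univariate, so that power is at least
   the (d + 1)-st, and the leading monomial of p divides it. *)
Require Import Defs.
From HB Require Import structures.
From mathcomp Require Import all_boot all_order all_fingroup all_algebra.
From mathcomp Require Import reals complex mpoly.
Import GRing.Theory.
Local Open Scope ring_scope.
Set Implicit Arguments.
Unset Strict Implicit.
Unset Printing Implicit Defensive.

(** * Evaluating polynomials and monomials in an algebra *)

Lemma horner_algE (F : nzSemiRingType) (A : semiAlgType F) (a : A) (p : {poly F}) :
  horner_alg a p = \sum_(k < size p) p`_k *: a ^+ k.
Proof.
rewrite -{1}[p]coefK poly_def (linear_sum (horner_alg a)); apply: eq_bigr => k _.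
by rewrite linearZ rmorphXn /= horner_algX mulr_algl.
Qed.

Lemma horner_algEw (F : nzSemiRingType) (A : semiAlgType F) (a : A) (p : {poly F}) n :
  (size p <= n)%N -> horner_alg a p = \sum_(k < n) p`_k *: a ^+ k.
Proof.
move=> le_pn; rewrite horner_algE (big_ord_widen n (fun k => p`_k *: a ^+ k)) //.
rewrite big_mkcond; apply: eq_bigr => k _; case: ltnP => // le_pk.
by rewrite nth_default // scale0r.
Qed.

(** The target will be a matrix algebra, so commutation is asked only of the images of the
    variables; this suffices to merge the two ordered products. *)
Lemma comm_mmap1M n (R : nzRingType) (h : 'I_n -> R) m1 m2 :
  (forall i j, GRing.comm (h i) (h j)) ->
  mmap1 h (m1 + m2) = mmap1 h m1 * mmap1 h m2.
Proof.
move=> hC; rewrite /mmap1 -prodrM_comm => [|i j _ _].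
  by apply: eq_bigr => i _; rewrite mnmDE exprD.
by apply/commrX/commr_sym/commrX/hC.
Qed.

(** * Generated ideals and a divisibility criterion for Gröbner bases *)

Section IdealGen.
Variables (F : fieldType) (n : nat).
Implicit Types (f g : {mpoly F[n]}) (A B : {mpoly F[n]} -> Prop).

Lemma ideal_gen_sub A f : A f -> ideal_gen A f.
Proof.
move=> Af; exists [:: (1, f)]; split; last by rewrite big_seq1 mul1r.
by move=> cg; rewrite inE => /eqP->.
Qed.

Lemma ideal_gen0 A : ideal_gen A 0.
Proof. by exists [::]; rewrite big_nil. Qed.

Lemma ideal_genD A f g : ideal_gen A f -> ideal_gen A g -> ideal_gen A (f + g).
Proof.
move=> [r [Ar ->]] [s [As ->]]; exists (r ++ s); rewrite big_cat; split=> // cg.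
by rewrite mem_cat => /orP[/Ar|/As].
Qed.

Lemma ideal_genM A f g : ideal_gen A g -> ideal_gen A (f * g).
Proof.
move=> [r [Ar ->]]; exists [seq (f * cg.1, cg.2) | cg <- r]; split.
  by move=> _ /mapP[cg /Ar ? ->].
by rewrite big_map mulr_sumr; apply: eq_bigr => cg _; rewrite mulrA.
Qed.

Lemma ideal_genZ A (c : F) f : ideal_gen A f -> ideal_gen A (c *: f).
Proof. by rewrite -mul_mpolyC; exact: ideal_genM. Qed.

Lemma ideal_gen_trans A B f :
  (forall g, A g -> ideal_gen B g) -> ideal_gen A f -> ideal_gen B f.
Proof.
move=> sAB [r [Ar ->]]; rewrite big_seq.
elim/big_ind: _ => [||cg /Ar/sAB]; [exact: ideal_gen0|exact: ideal_genD|].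
exact: ideal_genM.
Qed.

(** Over a field, divisibility of leading monomials gives divisibility of leading terms: the
    cofactor is the quotient of the coefficients times ['X_[m - m']]. *)
Lemma groebner_basis_divides (le : rel 'X_{1..n}) (I : {mpoly F[n]} -> Prop)
    (G : seq {mpoly F[n]}) :
  (forall g, g \in G -> I g) ->
  (forall f m, I f -> leading_monomial le f m ->
     exists g m', [/\ g \in G, leading_monomial le g m' & (m' <= m)%MM]) ->
  groebner_basis le I G.
Proof.
move=> GI div; split=> // f; split; apply: ideal_gen_trans => h.
  by move=> [g [m [Gg lm ->]]]; apply: ideal_gen_sub; exists g, m; split=> //; apply: GI.
move=> [u [m [Iu lm ->]]]; have [g [m' [Gg lm' le_m]]] := div _ _ Iu lm.
have ng0 : g@_m' != 0 by rewrite -mcoeff_msupp; case: lm'.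
have -> : u@_m *: 'X_[m] = ((u@_m / g@_m') *: 'X_[m - m']) * (g@_m' *: 'X_[m']).
  by rewrite -scalerAl -scalerAr scalerA divfK // -mpolyXD submK.
by apply/ideal_genM/ideal_gen_sub; exists g, m'.
Qed.

End IdealGen.

(** * Powers of the smallest variable in the lexicographic order *)

Section LexLast.
Variables (F : fieldType) (n : nat) (t : 'S_n.+1).
Let z := t ord_max.

(** At the first position where [m] differs it is strictly smaller, so the power of [z] has a
    positive exponent there. That position can only be the last, and all earlier exponents of [m]
    vanish. *)
Lemma lex_leU_last m k :
  lex_le t m (U_(z) *+ k) -> m = (U_(z) *+ m z)%MM /\ (m z <= k)%N.
Proof.
case/orP => [/eqP->|/existsP[i /andP[lt_i /forallP eq_i]]].
  by rewrite mulmnE mnm1E eqxx mul1n.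
have ei : i = ord_max.
  apply: (@perm_inj _ t); apply/eqP; move: lt_i; rewrite mulmnE mnm1E eq_sym.
  by case: eqP; rewrite // mul0n.
rewrite ei mulmnE mnm1E eqxx mul1n in lt_i eq_i; split; last exact: ltnW.
apply/mnmP=> j; rewrite mulmnE mnm1E; case: eqVneq => [<-|ne_jz]; first by rewrite mul1n.
have /implyP := eq_i (t^-1%g j); rewrite permKV mulmnE mnm1E (negbTE ne_jz) => /(_ _)/eqP-> //.
rewrite ltn_neqAle -ltnS ltn_ord andbT; apply: contraNneq ne_jz => /val_inj e.
by rewrite /z -e permKV.
Qed.

Lemma lex_le_last_U i k : i != z -> lex_le t (U_(z) *+ k) U_(i).
Proof.
move=> ne_iz; apply/orP; right; apply/existsP; exists (t^-1%g i).
rewrite permKV mulmnE !mnm1E eqxx eq_sym (negbTE ne_iz) /=.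
apply/forallP=> j; apply/implyP => lt_j.
have lt_jm : (j < n)%N by apply: leq_trans lt_j _; rewrite -ltnS.
rewrite mulmnE !mnm1E /z (inj_eq perm_inj).
have /negbTE-> : ord_max != j by apply: contraTneq lt_jm => <-; rewrite ltnn.
rewrite mul0n eq_sym eqb0; apply: contraTneq lt_j => ->; by rewrite permK ltnn.
Qed.

Lemma lex_le_last_exp j k : (j <= k)%N -> lex_le t (U_(z) *+ j) (U_(z) *+ k).
Proof.
rewrite leq_eqVlt => /orP[/eqP->|lt_jk]; first by rewrite /lex_le eqxx.
apply/orP; right; apply/existsP; exists ord_max; rewrite !mulmnE mnm1E eqxx !mul1n lt_jk.
apply/forallP=> i; apply/implyP => lt_i; rewrite !mulmnE !mnm1E (inj_eq perm_inj).
by have /negbTE-> : ord_max != i by apply: contraTneq lt_i => <-; rewrite ltnn.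
Qed.

End LexLast.

(** * Multivariate polynomials in a single variable *)

Section Univariate.
Variables (F : fieldType) (n : nat) (i : 'I_n).
Implicit Type p : {poly F}.

Lemma mcoeff_horner_alg p m :
  (horner_alg ('X_i : {mpoly F[n]}) p)@_m = p`_(m i) *+ (m == (U_(i) *+ m i)%MM).
Proof.
set N := maxn (size p) (m i).+1.
(* [N] also exceeds [m i], so the term of index [m i] is present even beyond the degree of [p],
   where its coefficient is 0. *)
have ltN : (m i < N)%N by rewrite leq_max ltnSn orbT.
rewrite (@horner_algEw _ _ _ _ N) ?leq_maxl // raddf_sum (bigD1 (Ordinal ltN)) //=.
rewrite big1 ?addr0 => [|k ne_k]; rewrite mcoeffZ mcoeffXn.
  by rewrite eq_sym mulr_natr.
case: eqP => [e|_]; last by rewrite mulr0.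
case/eqP: ne_k; apply: val_inj => /=; rewrite -e mulmnE mnm1E eqxx mul1n; done.
Qed.

Lemma horner_alg_mpoly (f : {mpoly F[n]}) k :
  (forall m, m \in msupp f -> m = (U_(i) *+ m i)%MM /\ (m i < k)%N) ->
  f = horner_alg 'X_i (\poly_(j < k) f@_(U_(i) *+ j)).
Proof.
move=> hf; apply/mpolyP=> m; rewrite mcoeff_horner_alg coef_poly.
case: (boolP (m \in msupp f)) => [/hf[e ->]|nm]; first by rewrite -e eqxx.
rewrite (memN_msupp_eq0 nm); case: eqP => // <-.
by rewrite (memN_msupp_eq0 nm) if_same.
Qed.

End Univariate.

(** * Leading monomials of the triangular system *)

Section LeadLast.
Variables (F : fieldType) (n : nat) (t : 'S_n.+1).
Let z := t ord_max.
Implicit Type p : {poly F}.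

Lemma leading_monomial_horner p k : size p = k.+1 ->
  leading_monomial (lex_le t) (horner_alg ('X_z : {mpoly F[n.+1]}) p) (U_(z) *+ k)%MM.
Proof.
move=> sp; split=> [|m]; rewrite mcoeff_msupp mcoeff_horner_alg.
  rewrite mulmnE mnm1E eqxx mul1n eqxx mulr1n.
  by rewrite -[k]/k.+1.-1 -sp -lead_coefE lead_coef_eq0 -size_poly_eq0 sp.
case: (eqVneq m) => [->|]; last by rewrite mulr0n eqxx.
rewrite !mulmnE mnm1E eqxx mul1n mulr1n => ne0; apply: lex_le_last_exp.
by rewrite -ltnS -sp; apply: contraR ne0; rewrite -leqNgt => /leq_sizeP->.
Qed.

(** Any other variable exceeds every power of the smallest one, whatever the degree of [p]. *)
Lemma leading_monomial_shear i p : i != z ->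
  leading_monomial (lex_le t) ('X_i - horner_alg ('X_z : {mpoly F[n.+1]}) p) U_(i)%MM.
Proof.
move=> ne_iz; split=> [|m]; rewrite mcoeff_msupp mcoeffB mcoeffX mcoeff_horner_alg.
  by rewrite eqxx mnm1E (negbTE ne_iz) mulm0n mnm1_eq0 subr0 oner_eq0.
case: (eqVneq U_(i)%MM m) => [->|_]; first by rewrite /lex_le eqxx.
case: (eqVneq m) => [->|_]; last by rewrite mulr0n subrr eqxx.
by move=> _; apply: lex_le_last_U.
Qed.
End LeadLast.

(** * Splitting off the index 0, and polynomial bases with one element per degree *)

Lemma big_ord_pos (V : nmodType) d (E : 'I_d.+1 -> V) :
  \sum_k E k = E ord0 + \sum_(k < d.+1 | (1 <= k)%N) E k.
Proof. by rewrite (bigD1 ord0) //=; congr (_ + _); apply: eq_bigl => k; rewrite lt0n. Qed.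

(** Triangular elimination: subtracting a multiple of the [q i] of matching degree cancels the top
    coefficient of [f]. *)
Lemma poly_basis_span (F : fieldType) d (q : 'I_d.+1 -> {poly F}) (f : {poly F}) :
  (forall i, size (q i) = i.+1) -> (size f <= d.+1)%N ->
  exists c : 'I_d.+1 -> F, f = \sum_i c i *: q i.
Proof.
move=> sq; suff span k : (k <= d.+1)%N -> forall f : {poly F}, (size f <= k)%N ->
    exists c : 'I_d.+1 -> F, f = \sum_i c i *: q i by exact: span.
elim: k => [|k IH] lek {}f.
  rewrite leqn0 size_poly_eq0 => /eqP->; exists (fun=> 0).
  by rewrite big1 // => i _; rewrite scale0r.
move=> sf; pose i := Ordinal lek; pose a := f`_k / lead_coef (q i).
have lq0 : lead_coef (q i) != 0 by rewrite lead_coef_eq0 -size_poly_eq0 sq.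
have [|c fc] := IH (ltnW lek) (f - a *: q i).
  apply/leq_sizeP => j; rewrite leq_eqVlt => /orP[/eqP<-|lt_kj].
    rewrite coefB coefZ; suff -> : (q i)`_k = lead_coef (q i) by rewrite divfK ?subrr.
    by rewrite lead_coefE sq.
  by rewrite coefB coefZ !nth_default ?mulr0 ?subr0 // ?sq // (leq_trans sf).
exists (fun l => c l + a *+ (l == i)).
rewrite -[LHS](subrK (a *: q i)) fc.
under [RHS]eq_bigr do rewrite scalerDl.
rewrite big_split; congr (_ + _) => /=.
rewrite (bigD1 i) //= eqxx big1 ?addr0 // => l /negbTE->; by rewrite scale0r.
Qed.

(** * The scheme ideal as the kernel of evaluation *)

Section Evaluation.
Variables (F : fieldType) (X : finType) (d : nat) (S : assoc_scheme X d).
Variables (A : algType F) (D : 'I_d.+1 -> A).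
Hypothesis Scomm : commutative_scheme S.
Hypothesis D0 : D ord0 = 1.
Hypothesis DM : forall i j, D i * D j = \sum_k (inum S i j k)%:R *: D k.
Hypothesis Dfree : forall c : 'I_d.+1 -> F, \sum_i c i *: D i = 0 -> forall i, c i = 0.

(* [mmap_is_multiplicative] does not apply, as [A] need not be commutative. *)
Let phi (f : {mpoly F[d.+1]}) : A := mmap (in_alg A) D f.

Let DC i j : GRing.comm (D i) (D j).
Proof. by rewrite /GRing.comm !DM; apply: eq_bigr => k _; rewrite Scomm. Qed.

Let phiD f g : phi (f + g) = phi f + phi g. Proof. exact: mmapD. Qed.
Let phiB f g : phi (f - g) = phi f - phi g. Proof. exact: mmapB. Qed.
Let phiZ c f : phi (c *: f) = c *: phi f.
Proof. by rewrite /phi mmapZ /= mulr_algl. Qed.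
Let phi_sum I r (P : pred I) E : phi (\sum_(i <- r | P i) E i) = \sum_(i <- r | P i) phi (E i).
Proof. exact: (raddf_sum (mmap (in_alg A) D)). Qed.
Let phiX i : phi 'X_i = D i.
Proof. by rewrite /phi mmapX mmap1U. Qed.
Let phi1 : phi 1 = 1.
Proof. by rewrite -mpolyX0 /phi mmapX mmap11. Qed.

(** Multiplicativity by one variable is enough below: generators have degree at most two, and powers
    follow by induction. *)
Let phiMX f i : phi (f * 'X_i) = phi f * D i.
Proof.
elim/mpolyind: f => [|c m f _ _ IH]; first by rewrite mul0r /phi mmap0 mul0r.
rewrite mulrDl !phiD IH mulrDl; congr (_ + _).
rewrite -scalerAl -mpolyXD !phiZ -scalerAl; congr (_ *: _).
by rewrite /phi !mmapX comm_mmap1M // mmap1U.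
Qed.

Let phi_horner i p : phi (horner_alg 'X_i p) = horner_alg (D i) p.
Proof.
rewrite !horner_algE phi_sum; apply: eq_bigr => k _; rewrite phiZ; congr (_ *: _).
by elim: (k : nat) => [|e IH]; rewrite ?expr0 ?phi1 // !exprSr phiMX IH.
Qed.

Lemma scheme_ideal_ker f : scheme_ideal F S f -> phi f = 0.
Proof.
move=> [r [Ar ->]]; rewrite phi_sum big1_seq // => -[g h] /andP[_ /Ar] /= [->|].
  by rewrite mulrBr phiB phiMX D0 !mulr1 subrr.
move=> [i [j [_ ->]]].
(* Since [D ord0 = 1], the constant of the generator cancels the term [k = 0] of the product
   [D i * D j]. *)
rewrite !mulrBr !phiB mulrA !phiMX -mulrA DM big_ord_pos D0 mulrDr.
rewrite -scalerAr mulr1 mulr_natr -scaler_nat phiZ [X in X - _ - _]addrC addrK.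
rewrite mulr_sumr [g * _]mulr_sumr phi_sum; apply/eqP; rewrite subr_eq0; apply/eqP.
by apply: eq_bigr => k _; rewrite -!scalerAr phiZ phiMX.
Qed.

(** A linear form without constant term suffices, because ['X_ord0] is congruent to 1 and carries
    the constants. *)
Let reducible f := exists c : 'I_d.+1 -> F, scheme_ideal F S (f - \sum_k c k *: 'X_k).

Let redD f g : reducible f -> reducible g -> reducible (f + g).
Proof.
move=> [a fa] [b gb]; exists (fun k => a k + b k).
have -> : f + g - \sum_k (a k + b k) *: 'X_k
    = (f - \sum_k a k *: 'X_k) + (g - \sum_k b k *: 'X_k).
  rewrite addrACA -opprD -big_split; congr (_ - _).
  by apply: eq_bigr => k _; rewrite scalerDl.
exact: ideal_genD.
Qed.

Let redI f g : scheme_ideal F S (f - g) -> reducible g -> reducible f.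
Proof.
move=> fg [a ga]; exists a; rewrite -[f](subrK g) -addrA; exact: ideal_genD.
Qed.

Let redZ c f : reducible f -> reducible (c *: f).
Proof.
move=> [a fa]; exists (fun k => c * a k).
have -> : c *: f - \sum_k (c * a k) *: 'X_k = c *: (f - \sum_k a k *: 'X_k).
  by rewrite scalerBr scaler_sumr; congr (_ - _); apply: eq_bigr => k _; rewrite scalerA.
exact: ideal_genZ.
Qed.

Let red0 : reducible 0.
Proof. by exists (fun=> 0); rewrite big1 ?subr0; [exact: ideal_gen0|move=> *; rewrite scale0r]. Qed.

Let red_sum I r (P : pred I) E : (forall i, P i -> reducible (E i)) ->
  reducible (\sum_(i <- r | P i) E i).
Proof. by move=> ?; elim/big_ind: _. Qed.

Let redX i : reducible 'X_i.
Proof.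
exists (fun k => (k == i)%:R); rewrite (bigD1 i) //= eqxx scale1r big1 ?addr0 ?subrr.
  exact: ideal_gen0.
by move=> k /negbTE->; rewrite scale0r.
Qed.

Let X0_sub1 : scheme_ideal F S ('X_ord0 - 1).
Proof. by apply: ideal_gen_sub; left. Qed.

Let red1 : reducible 1.
Proof.
by apply: redI (redX ord0); rewrite -opprB -scaleN1r; apply: ideal_genZ.
Qed.

(** The generators cover only [1 <= i <= j]. The order of the factors is exchanged by commutativity,
    and a factor ['X_ord0] is removed by the generator ['X_ord0 - 1]. *)
Let redXX i j : reducible ('X_i * 'X_j).
Proof.
wlog le_ij : i j / (i <= j)%N.
  by move=> H; case/orP: (leq_total i j) => /H //; rewrite mulrC.
case: (posnP i) => [i0|i_gt0].
  have -> : i = ord0 by apply: val_inj.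
  apply: redI (redX j); rewrite -[X in _ - X]mul1r -mulrBl mulrC.
  exact: ideal_genM.
apply: (redI (g := (inum S i j ord0)%:R *: 1 +
   \sum_(k < d.+1 | (1 <= k)%N) (inum S i j k)%:R *: 'X_k)); last first.
  by apply: redD; [exact: redZ|apply: red_sum => k _; exact: redZ].
by rewrite opprD addrA scaler_nat; apply: ideal_gen_sub; right; exists i, j; rewrite i_gt0.
Qed.

Let redM f g : reducible f -> reducible g -> reducible (f * g).
Proof.
move=> [a fa] [b gb].
apply: (redI (g := (\sum_k a k *: 'X_k) * (\sum_k b k *: 'X_k))); last first.
  rewrite mulr_suml; apply: red_sum => i _; rewrite mulr_sumr; apply: red_sum => j _.
  by rewrite -scalerAl -scalerAr; do 2!apply: redZ.
set u := \sum_k _; set v := \sum_k _.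
have -> : f * g - u * v = g * (f - u) + u * (g - v).
  by rewrite !mulrBr (mulrC g f) (mulrC g u) addrA subrK.
by apply: ideal_genD; apply: ideal_genM.
Qed.

Let reducibleP f : reducible f.
Proof.
elim/mpolyind: f => [//|c m f _ _ IH]; apply: redD => //; apply: redZ.
rewrite mpolyXE_id; elim/big_ind: _ => // i _.
by elim: (m i) => [|k IHk]; rewrite ?expr0 // exprS; apply: redM.
Qed.

Lemma scheme_idealP f : scheme_ideal F S f <-> phi f = 0.
Proof.
split=> [|phif]; first exact: scheme_ideal_ker.
have [c cf] := reducibleP f.
have c0 : forall k, c k = 0.
  apply: Dfree; move/scheme_ideal_ker: cf; rewrite phiB phif phi_sum sub0r => /eqP.
  by rewrite oppr_eq0 => /eqP e; rewrite -[RHS]e; apply: eq_bigr => k _; rewrite phiZ phiX.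
by move: cf; rewrite big1 ?subr0 // => k _; rewrite c0 scale0r.
Qed.

Lemma scheme_ideal_horner i p : scheme_ideal F S (horner_alg 'X_i p) <-> horner_alg (D i) p = 0.
Proof. by rewrite scheme_idealP phi_horner. Qed.

Lemma scheme_ideal_shear i j p :
  scheme_ideal F S ('X_j - horner_alg 'X_i p) <-> D j = horner_alg (D i) p.
Proof.
by rewrite scheme_idealP phiB phiX phi_horner; split=> [/subr0_eq|->//]; rewrite ?subrr.
Qed.

(** * The annihilator of the first adjacency matrix and the Gröbner basis *)

Variables (s : 'S_d.+1) (q : 'I_d.+1 -> {poly F}).
Let z := s (inord 1).
Hypothesis size_q : forall i, size (q i) = i.+1.
Hypothesis Dq : forall i, D (s i) = horner_alg (D z) (q i).

(** Expanding [f] in the [q i] turns its value at [D z] into a linear combination of the independent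
    [D (s i)]. *)
Lemma annihilator_eq0 (f : {poly F}) :
  (size f <= d.+1)%N -> horner_alg (D z) f = 0 -> f = 0.
Proof.
move=> /(poly_basis_span size_q)[c ->]; rewrite linear_sum => fD0.
have c0 k : c k = 0.
  have := Dfree (c := fun j => c (s^-1%g j)) _ (s k); rewrite permK; apply.
  rewrite -[RHS]fD0 (reindex_inj (@perm_inj _ s)); apply: eq_bigr => i _.
  by rewrite permK Dq linearZ /= mulr_algl.
by rewrite big1 // => i _; rewrite c0 scale0r.
Qed.

Lemma annihilator_exists :
  exists p : {poly F}, size p = d.+2 /\ horner_alg (D z) p = 0.
Proof.
(* The product of [D (s ord_max)] and [D z], written as a polynomial in [D z] in two ways: directly,
   and through the intersection numbers. Only the first has degree [d + 1]. *)
exists (q ord_max * 'X - \sum_i (inum S (s ord_max) z (s i))%:R *: q i); split.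
  rewrite size_polyDl size_mulX -?size_poly_eq0 ?size_q // size_polyN.
  apply: leq_ltn_trans (size_sum _ _ _) _; rewrite ltnS; apply/bigmax_leqP => i _.
  by apply: leq_trans (size_scale_leq _ _) _; rewrite size_q.
rewrite rmorphB rmorphM /= horner_algX -Dq DM linear_sum (reindex_inj (@perm_inj _ s)).
apply/eqP; rewrite subr_eq0; apply/eqP/eq_bigr => i _.
by rewrite linearZ /= mulr_algl Dq.
Qed.

Hypothesis s0 : s ord0 = ord0.
Hypothesis d_gt0 : (0 < d)%N.

Lemma triangular_groebner (t : 'S_d.+1) (p : {poly F}) :
  t ord_max = z -> size p = d.+2 -> horner_alg (D z) p = 0 ->
  groebner_basis (lex_le t) (scheme_ideal F S) (triangular_system s p q).
Proof.
move=> tz size_p pD0.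
have val1 : (inord 1 : 'I_d.+1) = 1%N :> nat by rewrite inordK.
have s_neq_z (i : 'I_d.+1) : i != 1%N :> nat -> s i != z.
  by move=> ne_i1; rewrite /z (inj_eq perm_inj) -val_eqE /= val1.
have ne0z : ord0 != z by rewrite -s0 s_neq_z.
(* This puts ['X_ord0 - 1] in the same form as the other elements, with the constant polynomial
   1. *)
have X0 : 'X_ord0 - 1 = 'X_ord0 - horner_alg ('X_z : {mpoly F[d.+1]}) 1 by rewrite rmorph1.
apply: groebner_basis_divides => [g|f m If lm].
  rewrite !inE => /or3P[/eqP->|/eqP->|/mapP[j _ ->]].
  - exact: X0_sub1.
  - exact/scheme_ideal_horner.
  - exact/scheme_ideal_shear.
have [m0|m0] := posnP (m ord0); last first.
  exists ('X_ord0 - 1), U_(ord0)%MM; split; first by rewrite inE eqxx.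
    by rewrite X0 -tz; apply: leading_monomial_shear; rewrite tz.
  by rewrite lep1mP -lt0n.
have [/existsP[j /andP[j_ge2 mj]]|nj] := boolP [exists j : 'I_d.+1, (2 <= j)%N && (m (s j) != 0)].
  exists ('X_(s j) - horner_alg 'X_z (q j)), U_(s j)%MM; split; last by rewrite lep1mP.
    by rewrite !inE; apply/or3P/Or33/mapP; exists j; rewrite // mem_filter j_ge2 mem_enum.
  by rewrite -tz; apply: leading_monomial_shear; rewrite tz s_neq_z // gtn_eqF.
(* Neither ['X_ord0] nor any ['X_(s j)] with [2 <= j] divides [m], so only the variable [z] is
   left. *)
have em : m = (U_(z) *+ m z)%MM.
  apply/mnmP => i; rewrite mulmnE mnm1E; case: (eqVneq z i) => [<-|ne_zi]; first by rewrite mul1n.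
  have esi := permKV s i; rewrite mul0n -{}esi; move: nj; rewrite negb_exists => /forallP/(_ (s^-1%g i)).
  rewrite negb_and negbK -ltnNge ltnS leq_eqVlt ltnS leqn0 => /orP[|/eqP//].
  case/orP => [/eqP e1|/eqP e0]; last by rewrite [s^-1%g i](_ : _ = ord0) ?s0 //; apply: val_inj.
  by case/eqP: ne_zi; rewrite /z -[RHS](permKV s); congr (s _); apply: val_inj; rewrite /= val1.
have [lt_m|ge_m] := ltnP (m z) d.+1; last first.
  exists (horner_alg 'X_z p), (U_(z) *+ d.+1)%MM; split; first by rewrite !inE eqxx orbT.
    by rewrite -tz; apply: leading_monomial_horner.
  apply/mnm_lepP => i; rewrite mulmnE mnm1E; case: eqP => [<-|_]; by rewrite ?mul1n ?mul0n.
case: lm => fm le_m.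
(* All monomials of [f] lie below a power of the smallest variable, hence are powers of it, here of
   exponent at most [d]. *)
have ef : f = horner_alg 'X_z (\poly_(j < d.+1) f@_(U_(z) *+ j)).
  apply: horner_alg_mpoly => m' /le_m; rewrite em -tz => /lex_leU_last; rewrite tz => -[em' le_m'].
  by split; [|exact: leq_ltn_trans le_m' lt_m].
have u0 : \poly_(j < d.+1) f@_(U_(z) *+ j) = 0.
  by apply: annihilator_eq0; [exact: size_poly|apply/scheme_ideal_horner; rewrite -ef].
by move: fm; rewrite ef u0 rmorph0 msupp0.
Qed.

End Evaluation.

(** * The equivalence for matrices with the multiplication table of the scheme *)

Lemma mx_evalE (F : fieldType) n (p : {poly F}) (A : 'M[F]_n.+1) : mx_eval p A = horner_alg A p.
Proof. by rewrite horner_algE. Qed.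

(** The size is a variable [n] rather than [#|X|], so that case analysis makes it a successor and
    the matrices an algebra. *)
Lemma mx_P_polynomial_groebner (F : fieldType) (X : finType) (d n : nat) (S : assoc_scheme X d)
    (D : 'I_d.+1 -> 'M[F]_n) :
  (0 < d)%N -> (0 < n)%N -> commutative_scheme S -> D ord0 = 1%:M ->
  (forall i j, D i *m D j = \sum_k (inum S i j k)%:R *: D k) ->
  (forall c : 'I_d.+1 -> F, \sum_i c i *: D i = 0 -> forall i, c i = 0) ->
  (exists (s : 'S_d.+1) (q : 'I_d.+1 -> {poly F}) (p : {poly F}),
    [/\ s ord0 = ord0,
        forall i, size (q i) = i.+1 /\ D (s i) = mx_eval (q i) (D (s (inord 1)))
      & forall a, root p a <-> eigenvalue (D (s (inord 1))) a]) <->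
  exists (s t : 'S_d.+1) (p : {poly F}) (q : 'I_d.+1 -> {poly F}),
    [/\ s ord0 = ord0,
        forall j : 'I_d.+1, (2 <= j)%N -> lex_lt t U_(s (inord 1)) U_(s j),
        groebner_basis (lex_le t) (scheme_ideal F S) (triangular_system s p q),
        forall j : 'I_d.+1, (2 <= j)%N -> size (q j) = j.+1
      & size p = d.+2].
Proof.
case: n D => // n D d_gt0 _ Scomm D0 DM Dfree.
have val1 : (inord 1 : 'I_d.+1) = 1%N :> nat by rewrite inordK.
split=> [[s [q [_ [s0 /all_and2[size_q Dq] _]]]]|[s [t [p [q [s0 _ [GI _] size_q _]]]]]].
  have {}Dq i : D (s i) = horner_alg (D (s (inord 1))) (q i) by rewrite -mx_evalE.
  have [p [size_p pD0]] := annihilator_exists DM size_q Dq.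
  (* The order lists the variables from the largest down, so the transposition moves [s (inord 1)]
     to the last place. *)
  pose t := (tperm (inord 1) ord_max * s)%g.
  have tz : t ord_max = s (inord 1) by rewrite permM tpermR.
  exists s, t, p, q; split=> //; last first.
    exact: (triangular_groebner Scomm D0 DM Dfree size_q Dq s0 d_gt0 tz size_p pD0).
  move=> j j_ge2; have ne_j : s j != s (inord 1).
    by rewrite (inj_eq perm_inj) -val_eqE /= val1 gtn_eqF.
  rewrite -tz in ne_j *; have := lex_le_last_U 1 ne_j.
  by rewrite mulm1n /lex_le eq_mnm1 eq_sym (negbTE ne_j).
(* The system fixes [q i] only for [2 <= i]; the indices 0 and 1 receive the polynomials 1 and
   ['X]. *)
exists s, (fun i : 'I_d.+1 => if (i < 2)%N then 'X^i else q i).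
(* Only the set of roots is prescribed for this polynomial, so the characteristic polynomial
   serves. *)
exists (char_poly (D (s (inord 1)))); split=> // [i|a]; last by rewrite eigenvalue_root_char.
rewrite mx_evalE; case: ltnP => [|i_ge2]; last first.
  split; first exact: size_q.
  apply/(scheme_ideal_shear Scomm D0 DM Dfree)/GI; rewrite !inE; apply/or3P/Or33/mapP.
  by exists i; rewrite // mem_filter i_ge2 mem_enum.
rewrite size_polyXn rmorphXn /= horner_algX; case: i => [[|[|//]] lti] _ /=; split=> //.
  by rewrite expr0 -[RHS]D0 -s0; congr (D (s _)); apply: val_inj.
by rewrite expr1; congr (D (s _)); apply: val_inj; rewrite /= val1.
Qed.

(** * Adjacency matrices: independence and multiplication table *)

Section Adjacency.
Variables (F : fieldType) (X : finType) (d : nat) (S : assoc_scheme X d).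

Lemma srel_cover (x y : X) : exists k, (x, y) \in srel S k.
Proof.
have /and3P[/eqP cov _ _] := srel_partition S.
have : (x, y) \in cover [set srel S i | i : 'I_d.+1] by rewrite cov inE.
by case/bigcupP => _ /imsetP[k _ ->]; exists k.
Qed.

Lemma srel_uniq (x y : X) i j : (x, y) \in srel S i -> (x, y) \in srel S j -> i = j.
Proof.
have /and3P[_ /trivIsetP triv _] := srel_partition S => xi xj; apply/eqP.
apply: contraLR (xi) => ne_ij.
have /triv : srel S i \in [set srel S i | i : 'I_d.+1] by apply: imset_f.
move=> /(_ (srel S j) (imset_f _ isT)); rewrite (inj_eq (@srel_inj _ _ S)) => /(_ ne_ij).
by move/disjointFl => /(_ _ xj) ->.
Qed.

Lemma srel_nonempty i : exists x y, (x, y) \in srel S i.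
Proof.
have /and3P[_ _ n0] := srel_partition S.
have /set0Pn[[x y] xy] : srel S i != set0.
  by apply: contraNneq n0 => <-; apply: imset_f.
by exists x, y.
Qed.

Lemma sum_adjacency (c : 'I_d.+1 -> F) k a b : (enum_val a, enum_val b) \in srel S k ->
  (\sum_i c i *: adjacency_mx S F i) a b = c k.
Proof.
move=> abk; rewrite summxE (bigD1 k) //= !mxE abk mulr1 big1 ?addr0 // => i ne_ik.
rewrite !mxE; case: (boolP (_ \in srel S i)) => [abi|_]; last by rewrite mulr0.
by rewrite (srel_uniq abi abk) eqxx in ne_ik.
Qed.

(** No relation is empty, so each coefficient appears as an entry of the sum. *)
Lemma adjacency_free (c : 'I_d.+1 -> F) :
  \sum_i c i *: adjacency_mx S F i = 0 -> forall i, c i = 0.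
Proof.
move=> c0 i; have [x [y xy]] := srel_nonempty i.
have <- := @sum_adjacency c i (enum_rank x) (enum_rank y); first by rewrite c0 mxE.
by rewrite !enum_rankK.
Qed.

Lemma adjacency0 : adjacency_mx S F ord0 = 1%:M.
Proof.
apply/matrixP => a b; rewrite !mxE srel0; congr (nat_of_bool _)%:R; apply/idP/eqP.
  by case/imsetP => x _ [ax bx]; apply: enum_val_inj; rewrite ax.
by move=> ->; exact: imset_f.
Qed.

(** The entry of the product at a pair in [srel S k] counts the intermediate points [z], and this
    count is [inum S i j k]. *)
Lemma adjacencyM i j : adjacency_mx S F i *m adjacency_mx S F j
  = \sum_k (inum S i j k)%:R *: adjacency_mx S F k.
Proof.
apply/matrixP => a b; have [k abk] := srel_cover (enum_val a) (enum_val b).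
rewrite (sum_adjacency _ abk) -(inumP i j abk) mxE -sum1_card natr_sum.
rewrite [RHS]big_mkcond [RHS](reindex_onto enum_val enum_rank) => [|z _] /=; last exact: enum_rankK.
apply: eq_big => [c|c _]; first by rewrite enum_valK eqxx.
by rewrite !mxE inE -natrM mulnb; case: (_ && _).
Qed.

End Adjacency.

Theorem proposition3 (R : realType) (X : finType) (d : nat)
    (S : assoc_scheme X d) (hd : (1 <= d)%N)
    (hcomm : commutative_scheme S) (hsym : symmetric_scheme S) :
  P_polynomial R[i] S <->
  exists (s t : 'S_d.+1) (p : {poly R[i]}) (q : 'I_d.+1 -> {poly R[i]}),
    [/\ s ord0 = ord0,
        forall j : 'I_d.+1, (2 <= j)%N -> lex_lt t U_(s (inord 1)) U_(s j),
        groebner_basis (lex_le t) (scheme_ideal R[i] S)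
          (triangular_system s p q),
        forall j : 'I_d.+1, (2 <= j)%N -> size (q j) = j.+1
      & size p = d.+2].
Proof.
apply: mx_P_polynomial_groebner => //.
(* The matrix size is positive because the diagonal relation is nonempty. *)
- by have [x _] := srel_nonempty S ord0; apply/card_gt0P; exists x.
- exact: adjacency0.
- exact: adjacencyM.
- exact: adjacency_free.
Qed.
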